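(* We have $$\lim_{n\to\infty}\frac1n\cdot\frac{1}{n!}\sum_{\pi\in S_n}\mathrm{d}(\pi)=\frac13.$$
   Context: $S_n$ is the set of all permutations of $\{1,\dots,n\}$. For $\pi\in S_n$ the displacement of $\pi$ is $\mathrm{d}(\pi)=\frac1n\sum_{i=1}^n|i-\pi(i)|$. *)

(* Defs.v *)
From mathcomp Require Import all_boot all_order all_fingroup all_algebra.
From mathcomp Require Import all_classical all_reals all_analysis.

Set Implicit Arguments.
Unset Strict Implicit.
Unset Printing Implicit Defensive.

Import Order.TTheory GRing.Theory Num.Theory.
Import numFieldNormedType.Exports.

Local Open Scope ring_scope.

(* 'S_n permutes {0, ..., n-1} instead of {1, ..., n}; shifting both i and s i
   by one leaves |i - s i| unchanged. *)
Definition displacement (R : realType) (n : nat) (s : 'S_n) : R :=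
  n%:R^-1 * \sum_(i < n) `|(i : nat)%:R - (s i : nat)%:R|.

(* Main.v *)
(* For fixed [i] the value [s i] is equidistributed as [s] runs through [S_n],
   so the average of [displacement] is [n^-2] times the sum of [|i - j|] over all
   pairs [i, j < n]. That sum is [n (n^2 - 1) / 3], hence the [n]-th term equals
   [(1 - n^-2) / 3] for [n > 0]. *)
Require Import Defs.
From mathcomp Require Import all_boot all_order all_fingroup all_algebra.
From mathcomp Require Import all_classical all_reals all_analysis.
From mathcomp Require Import ring.

Set Implicit Arguments.
Unset Strict Implicit.
Unset Printing Implicit Defensive.

Import Order.TTheory GRing.Theory Num.Theory.
Import numFieldNormedType.Exports.

Local Open Scope classical_set_scope.
Local Open Scope ring_scope.

(** Double counting of [F (s k)] over all pairs [(k, s)]: summing over [s] first gives a value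
    independent of [k], summing over [k] first gives [\sum_j F j] since [s] is a bijection.
    Multiples in place of quotients let [V] be any [nmodType]. *)
Lemma sum_perm_eval (V : nmodType) n (F : 'I_n -> V) (i : 'I_n) :
  (\sum_(s : 'S_n) F (s i)) *+ n = (\sum_j F j) *+ n`!.
Proof.
have indep k : \sum_(s : 'S_n) F (s k) = \sum_(s : 'S_n) F (s i).
  (* In [tperm k i * s] the left factor acts first, so [k] goes to [i] and then to [s i]. *)
  rewrite (reindex_inj (mulgI (tperm k i))) /=.
  by apply: eq_bigr => s _; rewrite permM tpermL.
transitivity (\sum_k \sum_(s : 'S_n) F (s k)).
  by rewrite (eq_bigr _ (fun k _ => indep k)) sumr_const card_ord.
rewrite exchange_big /=.
rewrite (eq_bigr (fun=> \sum_j F j)) => [|s _]; last first.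
  by rewrite [RHS](reindex_perm s).
by rewrite sumr_const card_Sn.
Qed.

(** Induction on [n]: the new last row and last column each add [n (n + 1) / 2], and their common
    diagonal entry is 0. *)
Lemma sum_dist_ord (R : numFieldType) n :
  \sum_(i < n) \sum_(j < n) `|i%:R - j%:R| = n%:R * (n%:R ^+ 2 - 1) / 3 :> R.
Proof.
have sum_rev m : \sum_(i < m) (m%:R - i%:R) = m%:R * (m%:R + 1) / 2 :> R.
  elim: m => [|m IHm]; first by rewrite big_ord0 !mul0r.
  (* Dropping the first term, not the last, leaves [(m + 1) - (i + 1) = m - i], the sum for [m]. *)
  rewrite big_ord_recl (eq_bigr (fun i : 'I_m => m%:R - i%:R)) => [|i _].
    by rewrite IHm -natr1 subr0; field.
  by rewrite lift0 -!natr1; ring.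
elim: n => [|n IHn]; first by rewrite big_ord0 !mul0r.
rewrite big_ord_recr /=.
under eq_bigr => i _ do rewrite big_ord_recr /=.
rewrite big_split /= IHn big_ord_recr /= subrr normr0 addr0.
have dist (i : 'I_n) : `|n%:R - i%:R| = n%:R - i%:R :> R.
  by rewrite ger0_norm // subr_ge0 ler_nat ltnW.
under eq_bigr => i _ do rewrite distrC dist.
under [X in _ + X]eq_bigr => i _ do rewrite dist.
by rewrite sum_rev -!natr1; field.
Qed.

Lemma mean_displacement (R : realType) n : (0 < n)%N ->
  n`!%:R^-1 * \sum_(s : 'S_n) displacement R s = (n%:R ^+ 2 - 1) / (3 * n%:R).
Proof.
move=> n_gt0.
have n0 : n%:R != 0 :> R by rewrite pnatr_eq0 -lt0n.
have f0 : n`!%:R != 0 :> R by rewrite pnatr_eq0 -lt0n fact_gt0.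
have eval (i : 'I_n) : \sum_(s : 'S_n) `|i%:R - (s i : nat)%:R| =
    n`!%:R / n%:R * \sum_(j < n) `|i%:R - j%:R| :> R.
  apply: (mulfI n0).
  have := sum_perm_eval (fun j : 'I_n => `|i%:R - j%:R| : R) i.
  rewrite -[LHS]mulr_natl -[RHS]mulr_natl => ->.
  by rewrite [RHS]mulrA [n%:R * _]mulrCA divff // mulr1.
rewrite /displacement -mulr_sumr exchange_big /=.
under eq_bigr => i _ do rewrite eval.
by rewrite -mulr_sumr sum_dist_ord; field; rewrite n0 f0.
Qed.

Theorem corollary2p2 (R : realType) :
  (fun n : nat =>
     n%:R^-1 * (n`!%:R^-1 * \sum_(s : 'S_n) displacement R s)) @ \oo
  --> (1 / 3 : R).
Proof.
have -> : 1 / 3 = 1 / 3 - 1 / 3 * (0 * 0) :> R by rewrite !mulr0 subr0.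
(* The shift to index [n.+1] makes the index positive and turns its inverse into [harmonic n]. *)
rewrite -cvg_shiftS.
rewrite (_ : [sequence _]_n =
    fun n => 1 / 3 - 1 / 3 * (harmonic n * harmonic n)).
  apply: cvgB; first exact: cvg_cst.
  by apply: cvgM; [exact: cvg_cst | apply: cvgM; exact: cvg_harmonic].
apply/funext => n; rewrite /harmonic /= mean_displacement //.
by field; rewrite nat1r pnatr_eq0.
Qed.
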